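(* Let $\rho_\beta(\zeta)=\delta_{\mathrm{z},\beta}^2\,\zeta-V_\beta(\theta^-)$ be the reduced Poincaré map of the closed-loop biped with parameter $\beta$, as defined in the context, and let $\zeta_\beta^*=-\frac{V_\beta(\theta^-)}{1-\delta_{\mathrm{z},\beta}^2}$. Suppose that $\zeta^*:=\zeta_0^*$ is an exponentially stable fixed point of $\rho:=\rho_0$ (the case $\beta=0$). Let $\delta>0$ be such that for each $\beta\in B_\delta(0)\subset\mathbb{R}^{\dim(\beta)}$ the full-order fixed-point equation $P(x,\beta)=x$ has a unique solution $\mathrm{x}^*(\beta)$ near $x^*$, depending continuously on $\beta\in B_\delta(0)$, where $P(x^*,0)=x^*$ and $\frac{\partial P}{\partial x}|_{(x^*,0)}$ does not have $1$ as an eigenvalue. Then for any $\beta\in B_\delta(0)$, $\zeta_\beta^*$ is an exponentially stable fixed point of the discrete system $\zeta[k+1]=\rho_\beta(\zeta[k])$, $k\in\mathbb{Z}_+$.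
   Context: Model. A planar five-link biped with one degree of underactuation has configuration $q=(q_1,\dots,q_5)\in Q\subset\mathbb{R}^5$ and state $x=(q,\dot q)\in TQ=\{(q,\dot q): q\in Q,\ \dot q\in\mathbb{R}^5\}$. The swing-phase dynamics $D(q)\ddot q+C(q,\dot q)\dot q+G(q)=Bu$ ($D$ inertia matrix, $C$ Coriolis matrix, $G$ gravity vector, $u\in\mathbb{R}^4$) is written $\dot x=f(x)+g(x)u$; $q_1$ is the unactuated coordinate (the first row of $B$ is zero) and describes the absolute orientation of the robot, so $D$ does not depend on $q_1$. With $p_{\rm v}(q)$ the swing-foot height, $\mathcal{S}=\{(q,\dot q)\in TQ: p_{\rm v}(q)=0,\ \dot p_{\rm v}(q,\dot q)<0\}$. The impact map $\Delta:\mathcal{S}\to TQ$ has the form $\Delta(q,\dot q)=(\Delta_q q,\ \Delta_{\dot q}(q)\dot q)$, with $\Delta_q$ the relabeling of the legs. Outputs. Let $q_{\rm a}=(q_2,q_3,q_4,q_5)$ and $\theta(q)=q_1+q_2+\frac12 q_4$; $\theta$ increases monotonically during a step, from $\theta^+$ (post-impact) to $\theta^-$ (pre-impact). The nominal output is $h(q)=q_{\rm a}-h_{\rm d}(\theta(q))$ and, for $\beta\in\mathbb{R}^{\dim(\beta)}$, $h_\beta(q)=h(q)-h_{\rm s}(\theta(q),\beta)$, where $h_{\rm s}(\theta,\beta)$ is a (piecewise) polynomial in $\theta$ with coefficients depending on $\beta$ such that $h_{\rm s}(\theta,0)=0$ for $\theta^+\le\theta\le\theta^-$ and, with $\theta_{\rm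 s}=\theta^++0.9(\theta^--\theta^+)$, for all $\beta$: $h_{\rm s}(\theta^+,\beta)=0$, $\frac{\partial h_{\rm s}}{\partial\theta}(\theta^+,\beta)=0$; $h_{\rm s}(\theta_{\rm s},\beta)=0$, $\frac{\partial^i h_{\rm s}}{\partial\theta^i}(\theta_{\rm s},\beta)=0$, $i=1,2$; $h_{\rm s}(\theta,\beta)=0$ for $\theta_{\rm s}\le\theta\le\theta^-$. The zero dynamics surfaces are $\mathcal{Z}=\{(q,\dot q)\in TQ:h(q)=0,\ L_fh(q,\dot q)=0\}$ and $\mathcal{Z}_\beta=\{(q,\dot q)\in TQ:h_\beta(q)=0,\ L_fh_\beta(q,\dot q)=0\}$. The control is $u_\beta^*(x)=-\big(L_gL_fh_\beta(x)\big)^{-1}L_f^2h_\beta(x)$ (decoupling matrix invertible where used); $h_{\rm d}$ is designed so that $\Delta(\mathcal{S}\cap\mathcal{Z})\subset\mathcal{Z}$. There is a unique configuration $q^-$ at which $\mathcal{S}\cap\mathcal{Z}$ is reached; $\theta^-=\theta(q^-)$ and $\theta^+=\theta(q^+)$ with $q^+=\Delta_q q^-$. For every $\beta$, $\mathcal{S}\cap\mathcal{Z}_\beta=\mathcal{S}\cap\mathcal{Z}$ and $\mathcal{Z}_\beta$ is hybrid invariant (i.e. $\Delta(\mathcal{S}\cap\mathcal{Z}_\beta)\subset\mathcal{Z}_\beta$ and $\mathcal{Z}_\beta$ is invariant under the swing dynamics with $u_\beta^*$). Full Poincaré map. Let $\varphi_\beta(t,x)$ be the maximal solution of $\dot x=f(x)+g(x)u_\beta^*(x)$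 starting at $x$ at the initial time $t_k$ of the step, $T_I(x,\beta)=\inf\{t\ge t_k:\varphi_\beta(t,\Delta(x))\in\mathcal{S}\}$, and $P(x,\beta)=\varphi_\beta(T_I(x,\beta),\Delta(x))$, $P:\mathcal{S}\times\mathbb{R}^{\dim(\beta)}\to\mathcal{S}$. Reduced Poincaré map. Let $D_1(q)$ be the first row of $D(q)$ and $\zeta=\frac12(D_1(q)\dot q)^2$; $(\theta,\zeta)$ are coordinates on $\mathcal{Z}_\beta$, and $\zeta$ (evaluated just before impact) is a coordinate on $\mathcal{S}\cap\mathcal{Z}_\beta=\mathcal{S}\cap\mathcal{Z}$. Let $\lambda_\beta(q)=\begin{bmatrix}\partial h_\beta/\partial q\\ D_1(q)\end{bmatrix}^{-1}\begin{bmatrix}0_{4\times1}\\1\end{bmatrix}$ (so $\dot q=\lambda_\beta(q)\,D_1(q)\dot q$ on $\mathcal{Z}_\beta$). In the standard hybrid zero dynamics framework: (1) across impact on $\mathcal{S}\cap\mathcal{Z}_\beta$ the quantity $D_1(q)\dot q$ is multiplied by the constant $\delta_{\mathrm{z},\beta}=D_1(q^+)\,\Delta_{\dot q}(q^-)\,\lambda_\beta(q^-)$; (2) along the swing motion on $\mathcal{Z}_\beta$, $\zeta(\theta)=\zeta(\theta^+)-V_\beta(\theta)$, where $V_\beta(\theta)=-\int_{\theta^+}^{\theta}\frac{\kappa_{2,\beta}(s)}{\kappa_{1,\beta}(s)}\,ds$ with $\kappa_{1,\beta}=\frac{\partial\theta}{\partial q}\lambda_\beta$ and $\kappa_{2,\beta}=-G_1$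 ($G_1$ the first entry of $G$) evaluated at the unique $q$ with $h_\beta(q)=0$ and $\theta(q)=s$. Hence the restriction of $P(\cdot,\beta)$ to $\mathcal{S}\cap\mathcal{Z}$, in the coordinate $\zeta$, is $\rho_\beta(\zeta)=\delta_{\mathrm{z},\beta}^2\zeta-V_\beta(\theta^-)$. $B_\delta(0)$ is the open ball of radius $\delta$ about $0$. *)

(* Defs.v *)
From HB Require Import structures.
From mathcomp Require Import all_boot all_order all_algebra.
From mathcomp Require Import all_classical all_reals all_analysis.

Set Implicit Arguments.
Unset Strict Implicit.
Unset Printing Implicit Defensive.

Import Order.TTheory GRing.Theory Num.Theory.
Import numFieldNormedType.Exports.

Local Open Scope classical_set_scope.
Local Open Scope ring_scope.

Section Calculus.
Variable R : realType.

Definition basis_cv n (i : 'I_n) : 'cV[R]_n := delta_mx i 0.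

Definition jac n m (f : 'cV[R]_n -> 'cV[R]_m) (q : 'cV[R]_n) : 'M[R]_(m, n) :=
  \matrix_(i, j) ('D_(basis_cv j) f q) i 0.

Definition grad n (f : 'cV[R]_n -> R) (q : 'cV[R]_n) : 'rV[R]_n :=
  \row_j 'D_(basis_cv j) f q.

Definition lie (V W : normedModType R) (F : V -> V) (phi : V -> W) (x : V) : W :=
  'D_(F x) phi x.

Definition C1_on (V W : normedModType R) (A : set V) (f : V -> W) : Prop :=
  forall x, A x -> differentiable f x /\ forall v, {for x, continuous ('D_v f)}.

Definition C2_on (W : normedModType R) (A : set R) (f : R -> W) : Prop :=
  forall s, A s ->
    [/\ derivable f s 1, derivable (derive1 f) s 1 & {for s, continuous (derive1n 2 f)}].

Definition eucl_norm n (v : 'cV[R]_n) : R := Num.sqrt (\sum_i v i 0 ^+ 2).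

(* The norm of 'cV[R]_n in the library is the max norm, hence [eucl_norm]. *)
Definition open_ball0 n (delta : R) : set 'cV[R]_n :=
  [set b | eucl_norm b < delta].

Definition exp_stable_fixed_point (rho : R -> R) (z : R) : Prop :=
  rho z = z /\
  exists r c a : R, [/\ 0 < r, 0 < c, 0 < a < 1 &
    forall zeta : nat -> R, (forall k, zeta k.+1 = rho (zeta k)) ->
      `|zeta 0%N - z| < r ->
      forall k, `|zeta k - z| <= c * a ^+ k * `|zeta 0%N - z|].

End Calculus.

Definition state (R : realType) : normedModType R :=
  ('cV[R]_5 * 'cV[R]_5)%type.

(* Indices are shifted by one: q_1, ..., q_5 are the entries 0, ..., 4.
   The functions are total; only their values on [Qset] (on theta([Qset]) for
   [hd]) matter. [hs_piece b k i] is the polynomial giving component i of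
   h_s(., b) on the arguments that have exactly k breakpoints of [hs_knots]
   strictly below them. *)
Record biped (R : realType) (n : nat) := Biped {
  Qset     : set 'cV[R]_5;
  inertia  : 'cV[R]_5 -> 'M[R]_5;
  coriolis : 'cV[R]_5 -> 'cV[R]_5 -> 'M[R]_5;
  gravity  : 'cV[R]_5 -> 'cV[R]_5;
  inputB   : 'M[R]_(5, 4);
  pv       : 'cV[R]_5 -> R;
  impact_q  : 'M[R]_5;
  impact_dq : 'cV[R]_5 -> 'M[R]_5;
  hd       : R -> 'cV[R]_4;
  hs_knots : seq R;
  hs_piece : 'cV[R]_n -> nat -> 'I_4 -> {poly R};
  qminus   : 'cV[R]_5
}.

Section Model.
Variables (R : realType) (n : nat) (M : biped R n).
Local Notation St := (state R).
Implicit Types (q v : 'cV[R]_5) (x y : St) (b : 'cV[R]_n).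

Definition TQ : set St := [set x | Qset M x.1].

Definition drift x : St :=
  (x.2, invmx (inertia M x.1) *m
        (- (coriolis M x.1 x.2 *m x.2) - gravity M x.1)).

Definition ctrl x (u : 'cV[R]_4) : St :=
  (0, invmx (inertia M x.1) *m inputB M *m u).

Definition switch : set St :=
  [set x | [/\ TQ x, pv M x.1 = 0 & 'D_(x.2) (pv M) x.1 < 0]].

Definition impact x : St := (impact_q M *m x.1, impact_dq M x.1 *m x.2).

Definition qact q : 'cV[R]_4 := \col_i q (lift ord0 i) 0.

Definition theta q : R :=
  q (inord 0) 0 + q (inord 1) 0 + q (inord 3) 0 / 2.

Definition qplus : 'cV[R]_5 := impact_q M *m qminus M.
Definition theta_m : R := theta (qminus M).
Definition theta_p : R := theta qplus.
Definition theta_s : R := theta_p + 9 / 10 * (theta_m - theta_p).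

Definition hs b (s : R) : 'cV[R]_4 :=
  \col_i (hs_piece M b (count (fun c => c < s) (hs_knots M)) i).[s].

Definition hnom q : 'cV[R]_4 := qact q - hd M (theta q).
Definition hbeta b q : 'cV[R]_4 := hnom q - hs b (theta q).

Definition on_state (h : 'cV[R]_5 -> 'cV[R]_4) x : 'cV[R]_4 := h x.1.

Definition zero_dyn (h : 'cV[R]_5 -> 'cV[R]_4) : set St :=
  [set x | [/\ TQ x, h x.1 = 0 & lie drift (on_state h) x = 0]].

Definition Z : set St := zero_dyn hnom.
Definition Zb b : set St := zero_dyn (hbeta b).

Definition decoupling b x : 'M[R]_4 :=
  \matrix_(i, j) (lie (fun y => ctrl y (basis_cv R j))
                      (lie drift (on_state (hbeta b))) x) i 0.

Definition ustar b x : 'cV[R]_4 :=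
  - (invmx (decoupling b x) *m lie drift (lie drift (on_state (hbeta b))) x).

Definition closed_loop b x : St := drift x + ctrl x (ustar b x).

(* Solutions on [tk, tf) of the closed loop, whose domain is the part of TQ
   where the decoupling matrix is invertible. *)
Definition is_solution b (tk : R) x (tf : \bar R) (X : R -> St) : Prop :=
  [/\ (tk%:E < tf)%E, X tk = x,
      forall t, tk <= t -> (t%:E < tf)%E ->
        TQ (X t) /\ decoupling b (X t) \in unitmx,
      {within [set t | tk <= t /\ (t%:E < tf)%E], continuous X} &
      forall t, tk < t -> (t%:E < tf)%E ->
        is_derive t (1 : R) X (closed_loop b (X t))].

Definition is_maximal_solution b (tk : R) x (tf : \bar R) (X : R -> St) : Prop :=
  is_solution b tk x tf X /\
  forall tf' X', is_solution b tk x tf' X' ->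
    (tf' <= tf)%E /\ (forall t, tk <= t -> (t%:E < tf')%E -> X' t = X t).

(* If there is no maximal solution, its interval of definition [tk, tk) is
   empty, and then [impact_time] is +oo. *)
Definition maximal_solution b (tk : R) x : \bar R * (R -> St) :=
  xget (tk%:E, fun=> x) [set s | is_maximal_solution b tk x s.1 s.2].

Definition flow b (tk t : R) x : St := (maximal_solution b tk x).2 t.

Definition impact_time b (tk : R) x : \bar R :=
  ereal_inf [set t%:E | t in [set t : R |
    [/\ tk <= t, (t%:E < (maximal_solution b tk (impact x)).1)%E &
        switch (flow b tk t (impact x))]]].

Definition poincare (tk : R) x b : St :=
  flow b tk (fine (impact_time b tk x)) (impact x).

(* The Poincare map is partial: x is in its domain when the next impact occurs. *)
Definition poincare_dom (tk : R) b : set St :=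
  [set x | [/\ switch x, (impact_time b tk x < +oo)%E & switch (poincare tk x b)]].

Definition poincare_fixed (tk : R) b x : Prop :=
  poincare_dom tk b x /\ poincare tk x b = x.

Definition momentum_row q : 'rV[R]_5 := row ord0 (inertia M q).

Definition frame b q : 'M[R]_5 :=
  (col_mx (jac (hbeta b) q) (momentum_row q) : 'M[R]_(4 + 1, 5)).

Definition lambda b q : 'cV[R]_5 :=
  invmx (frame b q) *m (col_mx 0 1 : 'cV[R]_(4 + 1)).

Definition delta_z b : R :=
  (momentum_row qplus *m impact_dq M (qminus M) *m lambda b (qminus M)) 0 0.

Definition config_at b (s : R) : 'cV[R]_5 :=
  xget 0 [set q | [/\ Qset M q, hbeta b q = 0 & theta q = s]].

Definition kappa1 b (s : R) : R :=
  (grad theta (config_at b s) *m lambda b (config_at b s)) 0 0.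
Definition kappa2 b (s : R) : R := - gravity M (config_at b s) ord0 0.

Definition Vpot b (s : R) : R :=
  - \int[lebesgue_measure]_(t in `[theta_p, s]) (kappa2 b t / kappa1 b t).

Definition rho b (zeta : R) : R := delta_z b ^+ 2 * zeta - Vpot b theta_m.
Definition zeta_star b : R := - (Vpot b theta_m / (1 - delta_z b ^+ 2)).

(* C(q, v) v is determined by D through the Christoffel symbols, although
   C(q, v) itself is not. *)
Definition mechanical : Prop :=
  [/\ open (Qset M),
      C1_on (Qset M) (inertia M) /\
      (forall q, Qset M q -> (inertia M q)^T = inertia M q /\
        forall v, v != 0 -> 0 < (v^T *m inertia M q *m v) 0 0),
      (forall q v, Qset M q -> coriolis M q v *m v =
        \col_k \sum_i \sum_j
          (('D_(basis_cv R i) (inertia M) q) k j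
           - ('D_(basis_cv R k) (inertia M) q) i j / 2) * v i 0 * v j 0),
      (exists U : 'cV[R]_5 -> R, C1_on (Qset M) U /\
        forall q, Qset M q -> gravity M q = (grad U q)^T) &
      [/\ row ord0 (inputB M) = 0, \rank (inputB M) = 4%N &
          forall q (s : R), Qset M q -> Qset M (q + s *: basis_cv R ord0) ->
            inertia M (q + s *: basis_cv R ord0) = inertia M q]].

(* Relabeling the legs twice is the identity. *)
Definition impact_model : Prop :=
  [/\ C1_on (Qset M) (pv M), impact_q M *m impact_q M = 1%:M &
      forall x, switch x -> TQ (impact x)].

Definition output_design : Prop :=
  [/\ C2_on (theta @` Qset M) (hd M),
      forall b, C2_on (theta @` Qset M) (hs b),
      forall s, theta_p <= s <= theta_m -> hs 0 s = 0,
      forall b, hs b theta_p = 0 /\ derive1 (hs b) theta_p = 0 &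
      forall b, [/\ hs b theta_s = 0, derive1 (hs b) theta_s = 0,
                    derive1n 2 (hs b) theta_s = 0 &
                    forall s, theta_s <= s <= theta_m -> hs b s = 0]].

(* [qminus M] is the unique configuration in the projection of S /\ Z;
   theta increases along the steps that start from S /\ Z. *)
Definition hybrid_zero_dynamics (tk : R) : Prop :=
  [/\ forall q, (exists v, (switch `&` Z) (q, v)) <-> q = qminus M,
      theta_p < theta_m /\
      (forall b x, (switch `&` Z) x -> poincare_dom tk b x ->
        forall t1 t2, tk <= t1 -> t1 < t2 -> (t2%:E <= impact_time b tk x)%E ->
          theta (flow b tk t1 (impact x)).1 < theta (flow b tk t2 (impact x)).1),
      impact @` (switch `&` Z) `<=` Z,
      forall b, switch `&` Zb b = switch `&` Z &
      forall b, impact @` (switch `&` Zb b) `<=` Zb b /\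
        (forall x tf X, is_solution b tk x tf X -> Zb b x ->
           forall t, tk <= t -> (t%:E < tf)%E -> Zb b (X t))].

Definition standing_assumptions (tk : R) : Prop :=
  [/\ mechanical, impact_model, output_design & hybrid_zero_dynamics tk].

(* The inverses and quotients in lambda_beta, kappa_1 and V_beta are genuine. *)
Definition step_well_posed b : Prop :=
  forall s, theta_p <= s <= theta_m ->
    [/\ (exists q, [/\ Qset M q, hbeta b q = 0 & theta q = s]),
        (forall v, decoupling b (config_at b s, v) \in unitmx),
        frame b (config_at b s) \in unitmx & kappa1 b s != 0].

Definition tangent_switch x : set St := [set w | 'D_(w.1) (pv M) x.1 = 0].

(* Differential at x of a map defined on the hypersurface S near x; only its
   restriction to the tangent space of S at x is meaningful. *)
Definition differential_on_switch (P : St -> St) x (A : {linear St -> St}) : Prop :=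
  forall eps : R, 0 < eps -> \forall y \near x, switch y ->
    `|P y - P x - A (y - x)| <= eps * `|y - x|.

Definition poincare_nondegenerate (tk : R) b x : Prop :=
  (\forall y \near x, switch y -> poincare_dom tk b y) /\
  exists A : {linear St -> St},
    differential_on_switch (fun y => poincare tk y b) x A /\
    ~ (exists w, [/\ tangent_switch x w, w != 0 & A w = w]).

Definition fixed_point_branch (tk delta : R) (xs : St) (xb : 'cV[R]_n -> St) : Prop :=
  {within open_ball0 delta, continuous xb} /\
  exists2 N : set St, nbhs xs N &
    forall b, open_ball0 delta b ->
      [/\ N (xb b), poincare_fixed tk b (xb b) &
          forall x, N x -> poincare_fixed tk b x -> x = xb b].

End Model.

(* Main.v *)
Require Import Defs.
From HB Require Import structures.
From mathcomp Require Import all_boot all_order all_algebra.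
From mathcomp Require Import all_classical all_reals all_analysis.
From mathcomp Require Import lra ring.
Import Order.TTheory GRing.Theory Num.Theory.
Import numFieldNormedType.Exports.
Local Open Scope classical_set_scope.
Local Open Scope ring_scope.

(** The reduced map is affine, zeta |-> d * zeta - v with d = delta_z,beta ^ 2,
    and its fixed point is - v / (1 - d) unless d = 1.  Since d >= 0 and the
    error of an orbit is multiplied by d at each step, exponential stability
    amounts to d < 1 ([slope_lt1_of_exp_stable] and
    [exp_stable_of_slope_lt1]); the offset v = V_beta(theta^-) moves the fixed
    point but does not affect its stability.

    The slope does not depend on beta at all ([delta_z_beta]).  It involves
    beta only through lambda_beta(q^-), that is, through the Jacobian of h_beta
    at the pre-impact configuration.  The modification h_s(., beta) vanishes on
    [theta_s, theta^-] and is differentiable at theta^-, where its derivative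
    must therefore be its left derivative, 0.  So h_beta and h have the same
    Jacobian at q^-, whence delta_z,beta = delta_z,0, and the stability assumed
    for beta = 0 carries over to every beta. *)

Lemma iterate_affine {R : realType} {d v z : R} {zeta : nat -> R} :
  d * z - v = z -> (forall k, zeta k.+1 = d * zeta k - v) ->
  forall k, zeta k - z = d ^+ k * (zeta 0%N - z).
Proof.
move=> fixz step; elim=> [|k IH]; first by rewrite expr0 mul1r.
by rewrite exprS -mulrA -IH step -[in LHS]fixz; ring.
Qed.

(** If d >= 1, an orbit that starts off the fixed point never gets closer to
    it, which contradicts a bound by c * a ^ k with a < 1. *)
Lemma slope_lt1_of_exp_stable (R : realType) (d v z : R) :
  exp_stable_fixed_point (fun x => d * x - v) z -> d < 1.
Proof.
move=> [fixz [r [c [a [r_gt0 c_gt0 /andP[a_gt0 a_lt1] stab]]]]].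
rewrite ltNge; apply/negP => d_ge1.
(* any nonzero initial error less than r would do *)
pose zeta k := iter k (fun x => d * x - v) (z + r / 2).
have orbit k : zeta k.+1 = d * zeta k - v by [].
have dist0 : zeta 0%N - z = r / 2 by rewrite /zeta /=; ring.
have r2_gt0 : 0 < r / 2 by lra.
have near0 : `|zeta 0%N - z| < r by rewrite dist0 gtr0_norm //; lra.
have bound k : 1 <= c * a ^+ k.
  have := stab zeta orbit near0 k.
  rewrite (iterate_affine fixz orbit k) dist0 normrM (gtr0_norm r2_gt0).
  rewrite ler_pM2r //; apply: le_trans.
  by rewrite ger0_norm ?exprn_ege1 // exprn_ge0 // (le_trans ler01).
have /cvgrPdist_lt /(_ c^-1) : (a ^+ k @[k --> \oo] --> (0 : R)).
  by apply: cvg_expr; rewrite gtr0_norm.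
rewrite invr_gt0 => /(_ c_gt0) [N _ /(_ N (leqnn N))] /=.
rewrite sub0r normrN gtr0_norm ?exprn_gt0 // -(ltr_pM2l c_gt0) mulfV ?gt_eqF //.
by rewrite ltNge bound.
Qed.

Lemma exp_stable_of_slope_lt1 (R : realType) (d v : R) : 0 <= d -> d < 1 ->
  exp_stable_fixed_point (fun x => d * x - v) (- (v / (1 - d))).
Proof.
move=> d_ge0 d_lt1; set z := - (v / (1 - d)).
have fixz : d * z - v = z.
  by rewrite /z; field; rewrite subr_eq0 eq_sym lt_eqF.
(* the midpoint of d and 1 is a rate in (0, 1) even when d = 0 *)
split=> //; exists 1, 1, ((1 + d) / 2); split=> //; first by apply/andP; lra.
move=> zeta orbit _ k.
rewrite (iterate_affine fixz orbit k) normrM mul1r.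
rewrite ler_wpM2r // ger0_norm ?exprn_ge0 //.
by apply: lerXn2r; rewrite ?nnegrE; lra.
Qed.

(** When [f] is not derivable, neither is [f + g], and both derivatives take
    the same default value. *)
Lemma derive_addr0 (R : realType) (V W : normedModType R) (f g : V -> W) (q v : V) :
  derivable g q v -> 'D_v g q = 0 -> 'D_v (f + g) q = 'D_v f q.
Proof.
move=> dg Dg0; have [df|ndf] := pselect (derivable f q v).
  by rewrite deriveD // Dg0 addr0.
have ndfg : ~ derivable (f + g) q v.
  by move=> dfg; apply: ndf; rewrite -(addrK g f); exact: derivableB.
by rewrite /derive (dvgP ndf) (dvgP ndfg).
Qed.

(** The derivative, which exists by hypothesis, can be computed from the left,
    where the difference quotients vanish. *)
Lemma derive1_eq0_left (R : realType) (W : normedModType R) (F : R -> W) (s0 s : R) :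
  s0 < s -> (forall t, s0 <= t <= s -> F t = 0) -> derivable F s 1 ->
  derive1 F s = 0.
Proof.
move=> s0s F0 dF; rewrite derive1E /derive cvg_at_leftE //.
apply: cvg_lim => //.
have : (fun=> 0 : W) h @[h --> (0 : R)^'-] --> (0 : W) by exact: cvg_cst.
apply: cvg_trans; apply: near_eq_cvg.
near=> h.
have h0 : h < 0 by near: h; exact: nbhs_left_lt.
have hs : s0 - s <= h by near: h; apply: nbhs_left_ge; rewrite subr_lt0.
rewrite /= [h *: 1]mulr1 !F0 ?subr0 ?scaler0 //; apply/andP; lra.
Unshelve. all: by end_near.
Qed.

Lemma derive_comp_eq0 (R : realType) (V W : normedModType R) (f : V -> R)
    (F : R -> W) (q v : V) :
  differentiable f q -> derivable F (f q) 1 -> derive1 F (f q) = 0 ->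
  derivable (F \o f) q v /\ 'D_v (F \o f) q = 0.
Proof.
move=> df dF F'0; have /derivable1_diffP dF' := dF.
have dFf : differentiable (F \o f) q by exact: differentiable_comp.
split; first exact: diff_derivable.
have F'Z (c : R) : 'd F (f q) c = c *: 'D_1 F (f q).
  by rewrite deriveE // -linearZ /= -[c in LHS]mulr1.
by rewrite deriveE // diff_comp //= F'Z -derive1E F'0 scaler0.
Qed.

Lemma differentiable_theta (R : realType) (q : 'cV[R]_5) : differentiable (@theta R) q.
Proof.
apply: differentiableD; first by apply: differentiableD; exact: differentiable_coord.
by apply: differentiableM => //; exact: differentiable_coord.
Qed.

Lemma Qset_qminus {R : realType} {n : nat} {M : biped R n} {tk : R} :
  standing_assumptions M tk -> Qset M (qminus M).
Proof.
move=> [_ _ _ [uniq _ _ _ _]].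
by have /(proj2 (uniq _)) [v [[]]] : qminus M = qminus M by [].
Qed.

(** Differentiability at theta^- is two-sided because theta^- lies in
    theta([Qset]), on which h_s is assumed to be C^2; the flat piece
    [theta_s, theta^-] then forces the derivative. *)
Lemma derive1_hs_theta_m {R : realType} {n : nat} {M : biped R n} {tk : R} b :
  standing_assumptions M tk ->
  derivable (hs M b) (theta_m M) 1 /\ derive1 (hs M b) (theta_m M) = 0.
Proof.
move=> HM; have [_ _ [_ hsC2 _ _ hs0] [_ [tpm _] _ _ _]] := HM.
have thQ : (@theta R @` Qset M) (theta_m M).
  by exists (qminus M) => //; exact: Qset_qminus HM.
have [dhs _ _] := hsC2 b _ thQ.
split=> //; have [_ _ _ flat] := hs0 b.
apply: (@derive1_eq0_left _ _ _ (theta_s M)) => //.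
by rewrite /theta_s; lra.
Qed.

(** By the chain rule, the gradient of h_s(theta(q), beta) at q^- is a multiple
    of the derivative of h_s(., beta) at theta^-, which is 0. *)
Lemma jac_hbeta_qminus {R : realType} {n : nat} {M : biped R n} {tk : R} b :
  standing_assumptions M tk ->
  jac (hbeta M b) (qminus M) = jac (hnom M) (qminus M).
Proof.
move=> HM; apply/matrixP => i j; rewrite !mxE; congr (_ _ _).
have [dhs hs'0] := derive1_hs_theta_m b HM.
have [dc Dc0] := @derive_comp_eq0 _ _ _ _ _ (qminus M) (basis_cv R j)
  (@differentiable_theta R (qminus M)) dhs hs'0.
have -> : hbeta M b = hnom M + - (hs M b \o @theta R) by apply/funext.
by rewrite derive_addr0 ?deriveN ?Dc0 ?oppr0 //; exact: derivableN.
Qed.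

(** The impact matrix and the momentum row are evaluated at q^- and q^+, which
    are common to all beta, so only the Jacobian in [lambda] could vary. *)
Lemma delta_z_beta {R : realType} {n : nat} {M : biped R n} {tk : R} b b' :
  standing_assumptions M tk -> delta_z M b = delta_z M b'.
Proof.
by move=> HM; rewrite /delta_z /lambda /frame !(jac_hbeta_qminus _ HM).
Qed.

Theorem theorem1 (R : realType) (n : nat) (M : biped R n) (tk delta : R)
    (xs : state R) (xb : 'cV[R]_n -> state R)
    (HM : standing_assumptions M tk)
    (Hrho : exp_stable_fixed_point (rho M 0) (zeta_star M 0))
    (Hxs : poincare_fixed M tk 0 xs)
    (Hnd : poincare_nondegenerate M tk 0 xs)
    (Hdelta : 0 < delta)
    (Hwp : forall beta : 'cV[R]_n, open_ball0 delta beta -> step_well_posed M beta)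
    (Hbranch : fixed_point_branch M tk delta xs xb) :
  forall beta : 'cV[R]_n, open_ball0 delta beta ->
    exp_stable_fixed_point (rho M beta) (zeta_star M beta).
Proof.
move=> beta _; apply: exp_stable_of_slope_lt1; first exact: sqr_ge0.
by rewrite (delta_z_beta beta 0 HM); exact: slope_lt1_of_exp_stable Hrho.
Qed.
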